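(* Let $A\in\mathrm{SL}_2(\mathbb Z)$ and let $(\Pi,g)$ be the contact sub-Riemannian structure on $M_A=T^2\tilde\times_AS^1$ constructed in the context. If $\Pi$ is cooriented, then the topological entropy of the flow of the Reeb field $\nu_\alpha$ of $(\Pi,g)$ vanishes: $h_{\mathrm{top}}(\nu_\alpha)=0$.
   Context: Suspension: $T^2=\mathbb R^2/\mathbb Z^2$; $M_A$ is the quotient of the cylinder $\mathcal C=T^2(\varphi_1,\varphi_2)\times\mathbb R(\varphi_3)$ by the free action generated by $\hat A(\varphi_1,\varphi_2,\varphi_3)=(A(\varphi_1,\varphi_2),\varphi_3+1)$. $E$ is the identity matrix. Construction of $(\Pi,g)$: vector fields $\xi_1,\xi_2=\partial_{\varphi_3}$ are given on $\mathcal C$; $\Pi=\langle\xi_1,\xi_2\rangle$ and $g$ is the metric on $\Pi$ for which $\xi_1,\xi_2$ is an orthonormal frame; $(\Pi,g)$ is $\hat A$-invariant and descends to $M_A$. Below $\eta_1,\eta_2$ is a basis of translation-invariant vector fields on $T^2$. (0) $A=E$: $\xi_1=\cos(2\pi\varphi_3)\eta_1-\sin(2\pi\varphi_3)\eta_2$, with $\eta_i=\partial_{\varphi_i}$. (1) $A$ has real eigenvalues $\lambda>1$, $\lambda^{-1}$ with $A\eta_1=\lambda\eta_1$, $A\eta_2=\lambda^{-1}\eta_2$: $\xi_1=e^{\ln\lambda\cdot\varphi_3}\eta_1+e^{-\ln\lambda\cdot\varphi_3}\eta_2$. (2) $A$ has non-real eigenvalues $e^{\pm i\theta_k}$, $\theta_k=\pm\frac{2\pi}{k}$,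 $k\in\{3,4,6\}$, with $A\eta_1=\cos\theta_k\,\eta_1-\sin\theta_k\,\eta_2$, $A\eta_2=\sin\theta_k\,\eta_1+\cos\theta_k\,\eta_2$: $\xi_1=\cos(\theta_k\varphi_3)\eta_1-\sin(\theta_k\varphi_3)\eta_2$. (3) $A$ is a Jordan box with $A\eta_1=\eta_1$, $A\eta_2=\eta_1+\eta_2$: $\xi_1=\cos(2\pi\varphi_3)\eta_1+\sin(2\pi\varphi_3)(\eta_2+\varphi_3\eta_1)$. If the eigenvalues of $A$ are real and negative, the formula for $-A$ from (0), (1) or (3) is used; $\hat A$ then maps $\xi_1$ to $-\xi_1$, so $(\Pi,g)$ still descends to $M_A$. Reeb field: let $\alpha$ be the (unique up to sign) contact form with $\ker\alpha=\Pi$ normalized by $|d\alpha(\xi_1,\xi_2)|=1$ for a $g$-orthonormal frame $\xi_1,\xi_2$ of $\Pi$. The Reeb field $\nu_\alpha$ is defined by $\alpha(\nu_\alpha)=1$, $i_{\nu_\alpha}d\alpha=0$. The topological entropy of a vector field is that of the time-one map of its flow. *)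

(* Defs.v *)
From HB Require Import structures.
From mathcomp Require Import all_boot all_order all_algebra generic_quotient.
From mathcomp Require Import all_classical all_reals all_analysis.

Set Implicit Arguments.
Unset Strict Implicit.
Unset Printing Implicit Defensive.

Import Order.TTheory GRing.Theory Num.Theory.
Import numFieldNormedType.Exports.

Local Open Scope classical_set_scope.
Local Open Scope ring_scope.
Local Open Scope quotient_scope.

(* Topological entropy by open covers (Adler, Konheim, McAndrew).             *)
Section TopologicalEntropy.
Variables (R : realType) (T : topologicalType).
Implicit Types (U : set (set T)) (f : T -> T).

Definition open_cover U : Prop :=
  (forall u, U u -> open u) /\ \bigcup_(u in U) u = setT.

(* The least cardinality of a subcover; the infimum is a minimum as soon as a
   finite subcover exists, in particular when T is compact.                   *)
Definition subcover_number U : \bar R :=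
  ereal_inf [set (k%:R)%:E | k in
    [set k : nat | exists s : 'I_k -> set T,
       (forall i, U (s i)) /\ \bigcup_(i in [set: 'I_k]) s i = setT]].

(* The join of the covers f^-i(U), 0 <= i < n.                                *)
Definition iterated_join f U (n : nat) : set (set T) :=
  [set B | exists2 u : nat -> set T, forall i, (i < n)%N -> U (u i) &
     B = \bigcap_(i in [set i | (i < n)%N]) (iter i f @^-1` u i)].

Definition cover_entropy f U : \bar R :=
  limn (fun n => ((n%:R : R)^-1)%:E * lne (subcover_number (iterated_join f U n)))%E.

Definition topological_entropy f : \bar R :=
  ereal_sup [set cover_entropy f U | U in open_cover].

End TopologicalEntropy.

Definition SL2Z : Type := {A : 'M[int]_2 | \det A == 1}.

(* The universal univ_cover R^2 x R of the cylinder T^2 x R and of the mapping torus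
   M_A. Its tangent spaces are identified with itself by the coordinates.     *)
Notation univ_cover R := ('cV[R]_2 * R)%type.

Section MappingTorus.
Variables (R : realType) (A : SL2Z).

Definition mxpow (n : int) : 'M[R]_2 := map_mx intr (sval A ^ n).

(* deck m n covers the n-th power of Ahat(phi_1, phi_2, phi_3) =
   (A (phi_1, phi_2), phi_3 + 1), the column m in Z^2 being the choice of a
   lift. These maps are the deck transformations of the covering of M_A.      *)
Definition deck (m : 'cV[int]_2) (n : int) (p : univ_cover R) : univ_cover R :=
  (mxpow n *m p.1 + map_mx intr m, p.2 + n%:~R).

Definition ddeck (n : int) (v : univ_cover R) : univ_cover R := (mxpow n *m v.1, v.2).

Definition deck_rel (p q : univ_cover R) : bool :=
  `[< exists m n, q = deck m n p >].

Lemma deck_relP p q : reflect (exists m n, q = deck m n p) (deck_rel p q).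
Proof. exact: asboolP. Qed.

Lemma mxpow0 : mxpow 0 = 1%:M.
Proof. by rewrite /mxpow expr0z map_mx1. Qed.

Lemma sl2z_unit : sval A \is a GRing.unit.
Proof.
by case: A => B /= /eqP dB; rewrite -[_ \is a _]/(B \in unitmx) unitmxE dB unitr1.
Qed.

Lemma mxpowD i j : mxpow (i + j) = mxpow i *m mxpow j.
Proof. by rewrite /mxpow exprzDr ?sl2z_unit// map_mxM. Qed.

Lemma deck_id p : deck 0 0 p = p.
Proof.
by rewrite /deck mxpow0 mul1mx map_mx0 !addr0; case: p.
Qed.

Lemma deck_comp m n k l p :
  deck k l (deck m n p) = deck (sval A ^ l *m m + k) (l + n) p.
Proof.
rewrite /deck/= mxpowD mulmxDr mulmxA map_mxD map_mxM addrA.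
by rewrite intrD (addrC l%:~R) addrA.
Qed.

Lemma deck_rel_refl : reflexive deck_rel.
Proof. by move=> p; apply/deck_relP; exists 0, 0; rewrite deck_id. Qed.

Lemma deck_rel_sym : symmetric deck_rel.
Proof.
suff H p q : deck_rel p q -> deck_rel q p by move=> p q; apply/idP/idP; exact: H.
move=> /deck_relP[m [n ->]]; apply/deck_relP.
exists (- (sval A ^ (- n) *m m)), (- n).
by rewrite deck_comp subrr addNr deck_id.
Qed.

Lemma deck_rel_trans : transitive deck_rel.
Proof.
move=> q p r /deck_relP[m [n ->]] /deck_relP[k [l ->]]; apply/deck_relP.
by do 2 eexists; exact: deck_comp.
Qed.

Definition deck_equiv : equiv_rel (univ_cover R) :=
  EquivRel deck_rel deck_rel_refl deck_rel_sym deck_rel_trans.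

Definition mapping_torus : Type := quotient_topology {eq_quot deck_equiv}.

HB.instance Definition _ :=
  Topological.copy mapping_torus (quotient_topology {eq_quot deck_equiv}).

Definition torus_proj (p : univ_cover R) : mapping_torus :=
  \pi_{eq_quot deck_equiv} p.

End MappingTorus.

(* Tensor fields on M_A are tensor fields on the universal cover which are
   invariant under the deck transformations.                                  *)
Section Fields.
Variable R : realType.
Local Notation V := (univ_cover R).
Implicit Types (A : SL2Z) (alpha : V -> V -> R) (nu xi : V -> V).

Definition smooth (f : V -> R) : Prop :=
  forall (s : seq V) (p : V),
    differentiable (foldr (fun v (g : V -> R) => 'D_v g) f s) p.

Definition one_form alpha : Prop :=
  (forall p, scalar (alpha p)) /\ (forall v, smooth (fun p => alpha p v)).

Definition one_form_on A alpha : Prop :=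
  one_form alpha /\
  forall m n p v, alpha (deck A m n p) (ddeck A n v) = alpha p v.

Definition vector_field_on A nu : Prop :=
  forall m n p, nu (deck A m n p) = ddeck A n (nu p).

(* d alpha(u, v) = u(alpha(v)) - v(alpha(u)) - alpha([u, v]), where u and v are
   extended to constant, hence commuting, vector fields.                      *)
Definition dform alpha (p u v : V) : R :=
  'D_u (fun q => alpha q v) p - 'D_v (fun q => alpha q u) p.

Definition contact_form alpha : Prop :=
  forall p, exists u v w,
    alpha p u * dform alpha p v w + alpha p v * dform alpha p w u
      + alpha p w * dform alpha p u v != 0.

(* Only the values of the metric on vectors of the plane are meaningful.      *)
Record subriemannian := SubRiemannian {
  plane : V -> set V;
  metric : V -> V -> V -> R }.

Definition spanned_by_orthonormal_frame (S : subriemannian) (xi1 xi2 : V -> V) :=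
  (forall p, plane S p = [set a *: xi1 p + b *: xi2 p | a in setT & b in setT]) /\
  (forall p a b c d,
     metric S p (a *: xi1 p + b *: xi2 p) (c *: xi1 p + d *: xi2 p)
     = a * c + b * d).

Definition orthonormal_frame_at (S : subriemannian) (p e1 e2 : V) : Prop :=
  [/\ plane S p e1, plane S p e2,
      metric S p e1 e1 = 1, metric S p e2 e2 = 1 & metric S p e1 e2 = 0].

Definition has_kernel (S : subriemannian) alpha : Prop :=
  forall p, [set v | alpha p v = 0] = plane S p.

(* Since the plane is 2-dimensional, a one-form with this kernel does not
   vanish anywhere.                                                           *)
Definition cooriented A (S : subriemannian) : Prop :=
  exists beta, one_form_on A beta /\ has_kernel S beta.

Definition normalized_contact_form A (S : subriemannian) alpha : Prop :=
  [/\ one_form_on A alpha, contact_form alpha, has_kernel S alpha &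
      forall p e1 e2, orthonormal_frame_at S p e1 e2 ->
        `|dform alpha p e1 e2| = 1].

Definition reeb_field A alpha nu : Prop :=
  vector_field_on A nu /\
  forall p, alpha p (nu p) = 1 /\ forall v, dform alpha p (nu p) v = 0.

(* The curves t |-> Phi t x in M_A are integral curves of nu: they lift to
   integral curves on the universal cover.                                    *)
Definition flow_of A nu (Phi : R -> mapping_torus R A -> mapping_torus R A) :=
  forall p : V, exists gamma : R -> V,
    [/\ gamma 0 = p,
        forall t : R, is_derive t 1 gamma (nu (gamma t)) &
        forall t, Phi t (torus_proj A p) = torus_proj A (gamma t)].

End Fields.

(* The profile X(phi_3) is the component of xi_1 along T^2, which depends on
   phi_3 only. The profile of B = -A is used for A when the eigenvalues of A are
   real and negative.                                                         *)
Section Construction.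
Variable R : realType.
Implicit Types (B : 'M[R]_2) (X : R -> 'cV[R]_2).

Definition identity_profile B X : Prop :=
  B = 1%:M /\
  X = fun z => cos (2 * pi * z) *: delta_mx 0 0
               - sin (2 * pi * z) *: delta_mx 1 0.

Definition hyperbolic_profile B X : Prop :=
  exists lambda eta1 eta2,
    [/\ basis_of fullv [:: eta1; eta2], 1 < lambda,
        B *m eta1 = lambda *: eta1, B *m eta2 = lambda^-1 *: eta2 &
        X = fun z => expR (ln lambda * z) *: eta1 + expR (- ln lambda * z) *: eta2].

Definition elliptic_profile B X : Prop :=
  exists (k : nat) (theta : R) eta1 eta2,
    [/\ k \in [:: 3; 4; 6]%N,
        theta = 2 * pi / k%:R \/ theta = - (2 * pi / k%:R),
        basis_of fullv [:: eta1; eta2],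
        B *m eta1 = cos theta *: eta1 - sin theta *: eta2 /\
        B *m eta2 = sin theta *: eta1 + cos theta *: eta2 &
        X = fun z => cos (theta * z) *: eta1 - sin (theta * z) *: eta2].

Definition parabolic_profile B X : Prop :=
  exists eta1 eta2,
    [/\ basis_of fullv [:: eta1; eta2],
        B *m eta1 = eta1, B *m eta2 = eta1 + eta2 &
        X = fun z => cos (2 * pi * z) *: eta1
                     + sin (2 * pi * z) *: (eta2 + z *: eta1)].

Inductive frame_profile (A : SL2Z) (X : R -> 'cV[R]_2) : Prop :=
| FrameIdentity of identity_profile (mxpow R A 1) X
| FrameHyperbolic of hyperbolic_profile (mxpow R A 1) X
| FrameElliptic of elliptic_profile (mxpow R A 1) X
| FrameParabolic of parabolic_profile (mxpow R A 1) X
| FrameNegIdentity of identity_profile (- mxpow R A 1) X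
| FrameNegHyperbolic of hyperbolic_profile (- mxpow R A 1) X
| FrameNegParabolic of parabolic_profile (- mxpow R A 1) X.

Definition constructed_structure (A : SL2Z) (S : subriemannian R) : Prop :=
  exists2 X, frame_profile A X &
    spanned_by_orthonormal_frame S (fun p => (X p.2, 0)) (fun=> (0, 1)).

End Construction.

(* Main.v *)
(* The kernel condition makes alpha proportional to the annihilator of X(phi_3)
   in the torus directions, and the normalization |d alpha(xi_1, xi_2)| = 1
   fixes the factor up to a sign, so by connectedness of the fibres alpha
   depends on phi_3 only. Then the Reeb field is (N(phi_3), 0): its flow
   translates each torus fibre by a vector which is a C^1 function of phi_3.
   Hence nearby points separate at most linearly in time, about (M n)^3 boxes of
   side 1 / (M n) suffice to code orbits of length n, and
   log((M n)^3) / n tends to 0. *)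
Require Import Defs.
From HB Require Import structures.
From mathcomp Require Import all_boot all_order all_algebra.
From mathcomp Require Import all_classical all_reals all_analysis.
From mathcomp Require Import generic_quotient ring lra.

Set Implicit Arguments.
Unset Strict Implicit.
Unset Printing Implicit Defensive.

Import Order.TTheory GRing.Theory Num.Theory.
Import numFieldNormedType.Exports.

Local Open Scope classical_set_scope.
Local Open Scope ring_scope.

(** * Polynomial growth of subcovers and zero entropy *)

Lemma subcover_number_ge1 (R : realType) (T : topologicalType) (U : set (set T)) (x : T) :
  (1 <= subcover_number R U)%E.
Proof.
apply: le_ereal_inf_tmp => _ [k [s [_ sT]] <-].
rewrite lee_fin ler1n lt0n; apply/eqP => k0; subst k.
by have : setT x by []; rewrite -sT => -[[]].
Qed.

(** With [s = Num.sqrt (M * n.+1)], [ln s < s] bounds the logarithm by [2 * d * s], and division by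
    [n.+1] leaves [C / Num.sqrt n.+1]. *)
Lemma cvg_ln_pow_over_id (R : realType) (M d : nat) : (0 < M)%N ->
  (fun n => n.+1%:R^-1 * ln (((M * n.+1) ^ d)%N%:R) : R) @ \oo --> (0 : R).
Proof.
move=> M0; pose C : R := 2 * d%:R * Num.sqrt M%:R.
apply: (@squeeze_cvgr _ _ _ _ (fun=> 0) (fun n => C * Num.sqrt (harmonic n : R))).
- near=> n.
  have P0 : 0 < (M * n.+1)%N%:R :> R by rewrite ltr0n muln_gt0 M0.
  pose s : R := Num.sqrt (M * n.+1)%N%:R; pose t : R := Num.sqrt n.+1%:R^-1.
  have s0 : 0 < s by rewrite sqrtr_gt0.
  have s1 : 1 <= s by rewrite -[leLHS]sqrtr1 ler_sqrt// ler1n muln_gt0 M0.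
  have st : s * t = Num.sqrt M%:R.
    by rewrite -sqrtrM ?ltW// natrM mulfK// pnatr_eq0.
  have -> : n.+1%:R^-1 = t ^+ 2 by rewrite sqr_sqrtr// invr_ge0.
  have -> : ((M * n.+1) ^ d)%N%:R = s ^+ 2 ^+ d by rewrite natrX sqr_sqrtr ?ltW.
  rewrite !lnXn ?exprn_gt0//; apply/andP; split.
    by rewrite mulr_ge0 ?sqr_ge0// !mulrn_wge0// ln_ge0.
  rewrite /C -st -/t -[_ *+ 2]mulr_natr -[_ *+ d]mulr_natr.
  have -> : 2 * d%:R * (s * t) * t = t ^+ 2 * (s * 2 * d%:R) by ring.
  by rewrite ler_wpM2l ?sqr_ge0// !ler_wpM2r// ltW// ln_sublinear.
- exact: cvg_cst.
- have -> : 0 = C * Num.sqrt 0 :> R by rewrite sqrtr0 mulr0.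
  apply: cvgMr; apply: continuous_cvg cvg_harmonic; exact: sqrt_continuous.
Unshelve. all: by end_near. Qed.

(** The point [x] keeps every subcover non-empty, so the normalized logarithms are non-negative and
    are squeezed by [cvg_ln_pow_over_id]. *)
Lemma topological_entropy0 (R : realType) (T : topologicalType) (x : T) (f : T -> T) :
  (forall U, open_cover U -> exists M d : nat, (0 < M)%N /\ forall n,
     (subcover_number R (iterated_join f U n.+1) <= ((M * n.+1) ^ d)%N%:R%:E)%E) ->
  topological_entropy R f = 0%E.
Proof.
move=> poly.
rewrite /topological_entropy [X in ereal_sup X](_ : _ = [set 0%E]) ?ereal_sup1//.
have cover0 U : open_cover U -> cover_entropy R f U = 0%E.
  move=> /poly[M [d [M0 le]]]; apply/cvg_lim => //.
  (* The shift removes the index 0, where the factor [0^-1] is 0 and cannot be cancelled. *)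
  rewrite -cvg_shiftS.
  have H0 : (fun=> 0%E : \bar R) @ \oo --> (0%E : \bar R) by exact: cvg_cst.
  have H1 : (fun n => (n.+1%:R^-1 * ln (((M * n.+1) ^ d)%N%:R))%:E : \bar R) @ \oo
      --> (0%E : \bar R).
    by apply: cvg_EFin; [near=> n|exact: cvg_ln_pow_over_id].
  apply: (squeeze_cvge _ H0 H1).
  near=> n; apply/andP; split.
      by rewrite mule_ge0 ?lee_fin ?invr_ge0// lne_ge0 (subcover_number_ge1 _ _ x).
    have N0 := subcover_number_ge1 R (iterated_join f U n.+1) x.
    have p0 : 0 < ((M * n.+1) ^ d)%N%:R :> R by rewrite ltr0n expn_gt0 muln_gt0 M0.
    rewrite EFinM lee_pmul2l// ?lte_fin ?invr_gt0// -lne_EFin// lee_lne//.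
      by rewrite in_itv/= leey andbT (le_trans _ N0).
    by rewrite in_itv/= leey andbT lee_fin ltW.
apply/seteqP; split => [_ [U /cover0 + <-]//|_ ->].
(* The one-set cover makes the set of entropies non-empty; an empty supremum would be -oo. *)
exists [set setT]; first by split=> [u ->|]; [exact: openT|rewrite bigcup_set1].
by apply: cover0; split=> [u ->|]; [exact: openT|rewrite bigcup_set1].
Unshelve. all: by end_near. Qed.

Lemma subcover_number_le_card (R : realType) (T : topologicalType) (U : set (set T))
    (J : finType) (s : J -> set T) :
  (forall j, U (s j)) -> (forall x, exists j, s j x) ->
  (subcover_number R U <= #|J|%:R%:E)%E.
Proof.
move=> Us cov; apply: ge_ereal_inf; exists (#|J|%:R%:E)%E => //.
exists #|J| => //; exists (s \o enum_val); split => [i|]; first exact: Us.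
apply/seteqP; split => // x _; have [j sj] := cov x.
by exists (enum_rank j) => //=; rewrite enum_rankK.
Qed.

(** * Lebesgue numbers on the mapping torus and entropy of fibrewise translations *)

Section MappingTorusTopology.
Variables (R : realType) (A : SL2Z).
Local Notation V := (univ_cover R).
Local Notation proj := (@torus_proj R A).

Lemma torus_proj_deck m n p : proj (deck A m n p) = proj p.
Proof.
apply/eqmodP; change (is_true (deck_rel A (deck A m n p) p)).
by rewrite deck_rel_sym; apply/deck_relP; exists m, n.
Qed.

Lemma torus_proj_translate (p : V) (m : 'cV[int]_2) :
  proj (p.1 + map_mx intr m, p.2) = proj p.
Proof.
by rewrite -(torus_proj_deck m 0 p) /deck mxpow0 mul1mx addr0.
Qed.

Lemma open_torus_proj_preimage u : open u -> open (proj @^-1` u).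
Proof. by move=> ou; apply: open_comp => // p _; exact: pi_continuous. Qed.

(** Closed rather than half-open, so that it is compact; boundary points are then represented more
    than once. *)
Definition unit_square : set 'cV[R]_2 := [set v | forall i j, `[0, 1]%classic (v i j)].

Lemma translate_to_unit_square (v : 'cV[R]_2) :
  exists m : 'cV[int]_2, unit_square (v + map_mx intr m).
Proof.
exists (\matrix_(i, j) - Num.floor (v i j)) => i j; rewrite !mxE /= in_itv/=.
have := floor_itv (v i j); rewrite intrD rmorphN/=; lra.
Qed.

Lemma torus_proj_surj x : exists2 p, unit_square p.1 /\ `[0, 1]%classic p.2 & proj p = x.
Proof.
pose p := repr x; have px : proj p = x by exact: reprK.
(* The height is reduced first, since this moves the torus coordinates; the translation that then
   reduces those keeps the height. *)
pose q := deck A 0 (- Num.floor p.2) p.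
have [m um] := translate_to_unit_square q.1.
exists (q.1 + map_mx intr m, q.2); last by rewrite torus_proj_translate torus_proj_deck.
split=> //=; rewrite in_itv/=; have := floor_itv p.2; rewrite intrD rmorphN/=; lra.
Qed.

Lemma continuous_trmx m n : continuous (@trmx R m n).
Proof.
move=> M s /nbhs_ballP[e e0 es]; apply/nbhs_ballP; exists e => // N [_ MN].
by apply: es; split => // i j; rewrite !mxE; exact: MN.
Qed.

Lemma compact_unit_square : compact unit_square.
Proof.
have -> : unit_square = trmx @` [set v : 'rV[R]_2 | forall i, `[0, 1]%classic (v ord0 i)].
  apply/seteqP; split => [v uv|_ [v uv <-] i j].
    by exists v^T; rewrite ?trmxK// => i; rewrite mxE; exact: uv.
  by rewrite mxE (ord1 j); exact: uv.
apply: continuous_compact; first exact/continuous_subspaceT/continuous_trmx.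
by apply: (@rV_compact R 2 (fun=> `[0, 1]%classic)) => i; exact: segment_compact.
Qed.

(** The pulled-back cover has a Lebesgue number on a compact box, and integer translations, which
    preserve balls, carry it to all torus coordinates. The height stays in [0, 1] because powers of
    [A] may distort balls. *)
Lemma lebesgue_number_mapping_torus (U : set (set (mapping_torus R A))) : open_cover U ->
  exists2 delta : R, 0 < delta & forall p : V, `[0, 1]%classic p.2 ->
    exists2 u, U u & forall q : V, ball p delta q -> u (proj q).
Proof.
move=> [Uo Ucov].
have cK : compact (unit_square `*` `[0, 1] : set V).
  exact: compact_setX compact_unit_square (@segment_compact _ _ _).
have /compact_near_coveringP nc := cK.
pose P (e : R) (p : V) := exists2 u, U u & forall q : V, ball p e q -> u (proj q).
have : \forall e \near 0^'+, (unit_square `*` `[0, 1] : set V) `<=` P e.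
  apply: (nc R (0^'+) P) => p _ /=.
  have [u Uu up] : (\bigcup_(u in U) u) (proj p) by rewrite Ucov.
  have := open_torus_proj_preimage (Uo _ Uu); rewrite openE => /(_ p up).
  rewrite /interior => /nbhs_ballP [e /= e0 be].
  (* Half of the radius is spent on moving the centre from [p] to [p'], half on the ball about
     [p']. *)
  have e20 : 0 < e / 2 by rewrite divr_gt0.
  near=> p' e' => /=; exists u => // q pq; apply: be.
  apply: (@ball_split _ _ p'); first by near: p'; exact: nbhsx_ballx.
  apply: le_ball pq; near: e'; exact: nbhs_right_ltW.
move=> /(filterI (nbhs_right_gt 0)) /filter_ex[delta [delta0 sub]].
exists delta => // p p2; have [m um] := translate_to_unit_square p.1.
have [u Uu uq] := sub (_, _) (conj um p2).
exists u => // q [pq1 pq2]; rewrite -(torus_proj_translate q m); apply: uq.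
split=> //=; split=> // i j; move: pq1 => -[_ /(_ i j)].
by rewrite /ball/= !mxE opprD addrACA subrr addr0.
Unshelve. all: by end_near. Qed.

(** The index is the integer part of [t * K], except that [t] near 1 takes the last node, which is
    still within [K^-1]. *)
Lemma grid_approx (K : nat) (t : R) : `[0, 1]%classic t -> (0 < K)%N ->
  exists j : 'I_K, `|j%:R / K%:R - t| <= K%:R^-1.
Proof.
case: K => // K; rewrite /= in_itv/= => /andP[t0 t1] _.
have K0 : 0 < K.+1%:R :> R by rewrite ltr0n.
have [tK|tK] := ltP (t * K.+1%:R) K%:R; last first.
  exists ord_max => /=; rewrite -(ler_pM2r K0) -[X in _ * X](gtr0_norm K0) -normrM mulrBl.
  rewrite divfK ?mulVf ?gt_eqF// ler_norml.
  have : t * K.+1%:R <= K%:R + 1 by rewrite natr1 ler_piMl// ltW.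
  by move: tK; lra.
have tK0 : 0 <= t * K.+1%:R by rewrite mulr_ge0// ltW.
have := Num.Theory.truncn_itv tK0 => /andP[le1 lt1].
have jK : (Num.truncn (t * K.+1%:R) < K.+1)%N.
  by rewrite -(ltr_nat R) (le_lt_trans le1)// (lt_trans tK)// ltr_nat.
exists (Ordinal jK) => /=.
rewrite -(ler_pM2r K0) -[X in _ * X](gtr0_norm K0) -normrM mulrBl.
rewrite divfK ?mulVf ?gt_eqF// ler_norml; move: le1 lt1; rewrite -natr1; lra.
Qed.

(** The [k]-th iterate adds [k] times [N] and keeps the height, so a coordinate error 1/K grows to
    at most (1 + L k)/K. A grid of K^3 nodes therefore codes orbits of length [n.+1] once K is a
    large fixed multiple of [n.+1]. *)
Lemma topological_entropy_shear (f : mapping_torus R A -> mapping_torus R A)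
    (N : R -> 'cV[R]_2) (L : R) :
  (forall p, f (proj p) = proj (p.1 + N p.2, p.2)) ->
  (forall (x y : R) i j, `[0, 1]%classic x -> `[0, 1]%classic y ->
     `|N x i j - N y i j| <= L * `|x - y|) ->
  topological_entropy R f = 0%E.
Proof.
move=> fE lipN; apply: (topological_entropy0 (proj 0)) => U /[dup] [[_ _]].
move=> /lebesgue_number_mapping_torus[delta delta0 leb].
have itf k p : iter k f (proj p) = proj (p.1 + N p.2 *+ k, p.2).
  by elim: k => [|k IH] /=; rewrite ?addr0 -?surjective_pairing// IH fE /= -addrA -mulrSr.
have L0 : 0 <= L.
  have := lipN 1 0 0 0; rewrite /= !in_itv/= !lexx ler01/= => /(_ isT isT).
  by rewrite subr0 normr1 mulr1; exact: le_trans.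
(* This choice gives [(1 + L) / M < delta]; for [k <= n] the error (1 + L k)/K with K = M (n + 1) is
   no larger. The exponent 3 counts coordinates. *)
pose M := (Num.truncn ((1 + L) / delta)).+1; exists M, 3; split=> // n.
have M0 : 0 < M%:R :> R by rewrite ltr0n.
have Mdelta : (1 + L) / M%:R < delta.
  rewrite ltr_pdivrMr// mulrC -ltr_pdivrMr//.
  by have /andP[] := truncn_itv (divr_ge0 (addr_ge0 ler01 L0) (ltW delta0)).
pose K := (M * n.+1)%N; have K0 : (0 < K)%N by [].
pose grid (j : 'I_K * 'I_K * 'I_K) : V :=
  (\col_(i < 2) ((if i == 0 then j.1.1 else j.1.2)%:R / K%:R), j.2%:R / K%:R).
have grid01 j : `[0, 1]%classic (grid j).2.
  rewrite /= in_itv/= divr_ge0//= ler_pdivrMr ?ltr0n// mul1r ler_nat.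
  by rewrite ltnW// ltn_ord.
have chooseP j k : exists u, U u /\
    forall q, ball ((grid j).1 + N (grid j).2 *+ k, (grid j).2) delta q -> u (proj q).
  have [u Uu uP] := leb ((grid j).1 + N (grid j).2 *+ k, (grid j).2) (grid01 j).
  by exists u.
(* [u (j, k)] is a member of the cover around the [k]-th iterate of node [j]; intersecting its
   preimages over all times gives the element of the join attached to [j]. *)
have {chooseP} [u uP] := choice (fun jk => chooseP jk.1 jk.2).
have -> : ((M * n.+1) ^ 3 = #|{: 'I_K * 'I_K * 'I_K}|)%N.
  by rewrite !card_prod card_ord !expnS expn0 muln1 mulnA.
apply: (@subcover_number_le_card _ _ _ _ (fun j =>
  \bigcap_(i in [set i | (i < n.+1)%N]) (iter i f @^-1` u (j, i)))).
  by move=> j; exists (fun i => u (j, i)) => // i _; have [] := uP (j, i).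
move=> x; have [q [q1 q2] <-] := torus_proj_surj x.
have [j0 j0P] := grid_approx (q1 0 0) K0.
have [j1 j1P] := grid_approx (q1 1 0) K0.
have [j2 j2P] := grid_approx q2 K0.
exists (j0, j1, j2) => k /= kn; rewrite itf; apply: (uP (_, _)).2 => /=.
have bound : K%:R^-1 * (1 + L * k%:R) < delta.
  apply: le_lt_trans Mdelta.
  rewrite mulrC ler_pdivrMr ?ltr0n// /K natrM mulrA divfK ?gt_eqF//.
  have : k%:R <= n%:R :> R by rewrite ler_nat.
  move=> /(ler_wpM2l L0); rewrite -natr1; have : 0 <= n%:R :> R by [].
  by nra.
have Kdelta : K%:R^-1 < delta.
  apply: le_lt_trans bound; rewrite ler_peMr ?invr_ge0// lerDl mulr_ge0//.
split=> /=; last exact: le_lt_trans Kdelta.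
split=> // i j; rewrite /ball/= !mxE !mulmxnE.
(* The error splits into the initial offset and [k] times the difference of the two velocities. *)
apply: le_lt_trans bound; rewrite opprD addrACA -mulrnBl mulrDr mulr1.
apply: le_trans (ler_normD _ _) _; apply: lerD.
  rewrite (ord1 j); have /predU1P[->|/eqP ->]// : (i == 0) || (i == 1).
  by case: i => [[|[|]]].
rewrite normrMn -[_ *+ k]mulr_natr [leRHS](_ : _ = L * K%:R^-1 * k%:R); last by ring.
rewrite ler_wpM2r//.
apply: le_trans (lipN _ _ _ _ _ _) _ => //; first exact: (grid01 (j0, j1, j2)).
by rewrite ler_wpM2l.
Qed.

End MappingTorusTopology.

(** * Calculus along curves and lines; covectors in the plane *)

Lemma C1_lipschitz (R : realType) (f df : R -> R) :
  (forall x : R, is_derive x (1 : R) f (df x)) -> continuous df ->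
  exists L, forall x y, `[0, 1]%classic x -> `[0, 1]%classic y ->
    `|f x - f y| <= L * `|x - y|.
Proof.
move=> fdf cdf.
(* The Lipschitz constant is the maximum of [|df|] on the segment, used through the mean value
   theorem. *)
have [c _ cmax] : exists2 c, c \in `[0, 1]%R & forall t : R, t \in `[0, 1]%R ->
    `|df t| <= `|df c|.
  apply: (@EVT_max R (fun t => `|df t|)) => //.
  apply/continuous_subspaceT => x.
  by apply: continuous_comp; [exact: cdf|exact: norm_continuous].
exists `|df c| => x y; wlog xy : x y / y <= x.
  move=> H x01 y01; have [/H->//|/ltW /H] := leP y x.
  by rewrite distrC [in leRHS]distrC; exact.
rewrite /= !in_itv/= => /andP[x0 x1] /andP[y0 y1].
have [|t + ->] := @MVT_segment R f df y x xy (fun t _ => fdf t).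
  by apply: derivable_within_continuous => t _; have [] := fdf t.
rewrite in_itv/= => /andP[yt tx]; rewrite normrM ler_wpM2r// cmax//.
by rewrite in_itv/= (le_trans y0)//= (le_trans tx).
Qed.

Lemma C1_div_lipschitz (R : realType) (f g df dg : R -> R) :
  (forall x : R, is_derive x (1 : R) f (df x)) -> continuous df ->
  (forall x : R, is_derive x (1 : R) g (dg x)) -> continuous dg -> (forall x, g x != 0) ->
  exists L, forall x y, `[0, 1]%classic x -> `[0, 1]%classic y ->
    `|f x / g x - f y / g y| <= L * `|x - y|.
Proof.
move=> fdf cdf gdg cdg g0.
have cont (h dh : R -> R) : (forall x : R, is_derive x (1 : R) h (dh x)) -> continuous h.
  by move=> hdh x; apply/differentiable_continuous/derivable1_diffP; have [] := hdh x.
apply: (@C1_lipschitz _ (fun x => f x / g x)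
  (fun x => f x *: (- (g x) ^- 2 *: dg x) + (g x)^-1 *: df x)).
  move=> x; have gV := is_deriveV (g0 x) (gdg x).
  exact: (@is_deriveM _ _ f (fun y => (g y)^-1)).
have cf := cont _ _ fdf; have cg := cont _ _ gdg.
have cgV : continuous (fun x => (g x)^-1) by move=> x; apply: cvgV => //; exact: cg.
move=> x; apply: cvgD; apply: cvgM; [exact: cf| |exact: cgV|exact: cdf].
apply: cvgM; last exact: cdg.
apply: cvgN; apply: cvgV; first by rewrite expf_neq0.
apply: cvgM; exact: cg.
Qed.

(** A linear form commutes with difference quotients, and continuity passes to the limit. This
    serves to read off coordinates of integral curves. *)
Lemma is_derive_comp_scalar (R : realType) (V : normedModType R) (l : V -> R)
    (gamma : R -> V) (t : R) (d : V) :
  scalar l -> continuous l ->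
  is_derive t (1 : R) gamma d -> is_derive t (1 : R) (l \o gamma) (l d).
Proof.
move=> ll cl [dg <-].
have l0 : l 0 = 0 by have := ll (-1) 0 0; rewrite scaler0 addr0 mulN1r addNr.
have lB a u v : l (a *: (u - v)) = a * (l u - l v).
  by rewrite -[a *: _]addr0 ll l0 addr0 -[- v]scaleN1r addrC ll mulN1r addrC.
have lE : (fun h => h^-1 *: (((l \o gamma) \o shift t) (h *: (1 : R)) - (l \o gamma) t)) =
    l \o (fun h => h^-1 *: ((gamma \o shift t) (h *: (1 : R)) - gamma t)).
  by apply/funext => h /=; rewrite lB.
have cvl :
    (fun h => h^-1 *: (((l \o gamma) \o shift t) (h *: (1 : R)) - (l \o gamma) t)) @ 0^'
    --> l ('D_1 gamma t).
  rewrite lE; apply: cvg_comp dg _; exact: cl.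
by apply: DeriveDef; [apply/cvg_ex; eexists; exact: cvl|exact: cvg_lim cvl].
Qed.

(** The two difference quotients are the same function, so partial derivatives in [phi_3] become
    derivatives in one variable. *)
Lemma derivable_along_fiber (R : realType) (U W : normedModType R) (G : U * R -> W)
    (p : U * R) : derivable G p (0, 1) ->
  is_derive p.2 (1 : R) (fun t => G (p.1, t)) ('D_(0, 1) G p).
Proof.
have E : (fun h : R => h^-1 *:
      (((fun t => G (p.1, t)) \o shift p.2) (h *: (1 : R)) - G (p.1, p.2))) =
    (fun h : R => h^-1 *: ((G \o shift p) (h *: (0, 1)) - G p)).
  apply/funext => h /=; congr (_ *: (G _ - G _)); last by case: (p).
  by rewrite /shift/=; case: (p) => a b; congr pair; rewrite /= scaler0 add0r.
by move=> dG; apply: DeriveDef; [rewrite /derivable E|rewrite /derive E].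
Qed.

Lemma continuous_coord_fst (R : realType) m n i j :
  continuous (fun p : 'M[R]_(m.+1, n.+1) * R => p.1 i j).
Proof.
move=> p; apply: (@continuous_comp _ _ _ fst (fun M : 'M[R]_(m.+1, n.+1) => M i j)).
  exact: cvg_fst.
exact: coord_continuous.
Qed.

(** Two plane covectors that kill the same non-zero vector are parallel: their determinant times the
    squared length is a combination of the two vanishing pairings. *)
Lemma proportional_of_common_kernel (F : idomainType) (y0 y1 a0 a1 b0 b1 : F) :
  y0 ^+ 2 + y1 ^+ 2 != 0 -> y0 * a0 + y1 * a1 = 0 -> y0 * b0 + y1 * b1 = 0 ->
  a0 * b1 = a1 * b0.
Proof.
move=> y0N0 a0E b0E; apply: (mulfI y0N0); apply/eqP; rewrite -subr_eq0.
have -> : (y0 ^+ 2 + y1 ^+ 2) * (a0 * b1) - (y0 ^+ 2 + y1 ^+ 2) * (a1 * b0) =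
  (y0 * b1 - y1 * b0) * (y0 * a0 + y1 * a1) +
  (y1 * a0 - y0 * a1) * (y0 * b0 + y1 * b1) by ring.
by rewrite a0E b0E !mulr0 addr0.
Qed.

(** A covector is determined by its pairings with a vector and with the quarter turn of that
    vector. *)
Lemma eq_of_orthogonal_coords (F : idomainType) (y0 y1 a0 a1 b0 b1 : F) :
  y0 ^+ 2 + y1 ^+ 2 != 0 -> y0 * a0 + y1 * a1 = y0 * b0 + y1 * b1 ->
  - y1 * a0 + y0 * a1 = - y1 * b0 + y0 * b1 -> a0 = b0 /\ a1 = b1.
Proof.
move=> yN0 E1 E2.
have N x0 x1 : (y0 ^+ 2 + y1 ^+ 2) * x0 =
    y0 * (y0 * x0 + y1 * x1) - y1 * (- y1 * x0 + y0 * x1).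
  by ring.
have N' x0 x1 : (y0 ^+ 2 + y1 ^+ 2) * x1 =
    y1 * (y0 * x0 + y1 * x1) + y0 * (- y1 * x0 + y0 * x1).
  by ring.
by split; apply: (mulfI yN0);
  [rewrite (N _ a1) (N _ b1) E1 E2|rewrite (N' a0) (N' b0) E1 E2].
Qed.

(** * The normalized contact form and its Reeb field in coordinates *)

Section ReebField.
Variables (R : realType) (S : subriemannian R) (X : R -> 'cV[R]_2).
Variable alpha : univ_cover R -> univ_cover R -> R.
Local Notation V := (univ_cover R).

Hypothesis frameS :
  spanned_by_orthonormal_frame S (fun p => (X p.2, 0)) (fun=> (0, 1)).
Hypothesis formA : one_form alpha.
Hypothesis kerA : has_kernel S alpha.
Hypothesis normA : forall p e1 e2, orthonormal_frame_at S p e1 e2 ->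
  `|dform alpha p e1 e2| = 1.

Let ez : V := (0, 1).
Let e i : V := (delta_mx i 0, 0).

Let alphaD p u v : alpha p (u + v) = alpha p u + alpha p v.
Proof. by have := formA.1 p 1 u v; rewrite scale1r mul1r. Qed.

Let alpha0 p : alpha p 0 = 0.
Proof. by apply: (addrI (alpha p 0)); rewrite -alphaD !addr0. Qed.

Let alphaZ p a u : alpha p (a *: u) = a * alpha p u.
Proof. by have := formA.1 p a u 0; rewrite alpha0 !addr0. Qed.

Lemma alpha_coords p (v : V) :
  alpha p v = v.1 0 0 * alpha p (e 0) + v.1 1 0 * alpha p (e 1) + v.2 * alpha p ez.
Proof.
rewrite -!alphaZ -!alphaD; congr (alpha p _); case: v => v z /=; congr pair => /=.
  apply/colP => i; rewrite !mxE /= !mulr0 addr0.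
  case: i => [[|[|//]]] /= ?; rewrite ?(mulr1, mulr0, addr0, add0r);
    by congr (v _ _); apply: val_inj.
by rewrite scaler0 scaler0 !add0r; exact/esym/mulr1.
Qed.

Lemma alpha_kernelP p v : alpha p v = 0 <-> exists a b, v = a *: (X p.2, 0) + b *: ez.
Proof.
have -> : alpha p v = 0 <-> plane S p v by rewrite -(kerA p).
rewrite frameS.1; split=> [[a _ [b _ <-]]|[a [b ->]]]; first by exists a, b.
by exists a => //; exists b.
Qed.

Lemma alpha_ez p : alpha p ez = 0.
Proof. by apply/alpha_kernelP; exists 0, 1; rewrite scale0r add0r scale1r. Qed.

Lemma alpha_X p : alpha p (X p.2, 0) = 0.
Proof. by apply/alpha_kernelP; exists 1, 0; rewrite scale0r addr0 scale1r. Qed.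

Lemma differentiable_alpha p v : differentiable (fun q => alpha q v) p.
Proof. exact: (formA.2 v [::]). Qed.

Lemma derivable_alpha p u v : derivable (fun q => alpha q v) p u.
Proof. exact/diff_derivable/differentiable_alpha. Qed.

Lemma derive_alpha_ez p u : 'D_u (fun q => alpha q ez) p = 0.
Proof.
rewrite (_ : (fun q => _) = cst 0) ?derive_cst//.
by apply/funext => q; exact: alpha_ez.
Qed.

(** This is the normalization on the frame: [alpha] kills [ez] everywhere, so only one term of
    [dform] survives. The vector [X p.2] is frozen at [p], hence the derivative sees the plane
    turn. *)
Lemma derive_alpha_X p : `|'D_ez (fun q => alpha q (X p.2, 0)) p| = 1.
Proof.
have := @normA p (X p.2, 0) ez; rewrite /dform derive_alpha_ez sub0r normrN; apply.
have [_ m] := frameS.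
have m11 := m p 1 0 1 0; have m12 := m p 1 0 0 1; have m22 := m p 0 1 0 1.
rewrite !(scale1r, scale0r, addr0, add0r) in m11 m12 m22.
split.
- by rewrite -(kerA p); exact: alpha_X.
- by rewrite -(kerA p); exact: alpha_ez.
- by rewrite m11; ring.
- by rewrite m22; ring.
- by rewrite m12; ring.
Qed.

(** If [X z] were 0, the function differentiated in [derive_alpha_X] would vanish identically. *)
Lemma X_neq0 z : (X z 0 0) ^+ 2 + (X z 1 0) ^+ 2 != 0.
Proof.
apply/eqP => X0.
have [x0 x1] : X z 0 0 = 0 /\ X z 1 0 = 0 by split; nra.
have := derive_alpha_X (0, z); rewrite (_ : (fun q => _) = cst 0).
  by rewrite derive_cst normr0 => /eqP; rewrite eq_sym oner_eq0.
by apply/funext => q; rewrite alpha_coords /= x0 x1 !mul0r !addr0.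
Qed.

(** The quarter turn of [X], transverse to the plane; as [alpha] kills [X] and [ez], its value on
    [JX] determines it. *)
Let JX z : V := (\col_i (if i == 0 then - X z 1 0 else X z 0 0), 0).

Lemma alpha_JX_neq0 p : alpha p (JX p.2) != 0.
Proof.
apply/eqP => /alpha_kernelP[a [b /(congr1 fst)/= /colP JE]].
have := JE 0; have := JE 1; rewrite !mxE/= => E1 E0.
by have /eqP := X_neq0 p.2; apply; nra.
Qed.

(** At equal heights both forms kill the same [X] in the torus directions. The product form avoids
    division and can be differentiated. *)
Lemma alpha_proportional p q u v : p.2 = q.2 -> u.2 = 0 -> v.2 = 0 ->
  alpha p u * alpha q v = alpha p v * alpha q u.
Proof.
move=> pq u0 v0; have := alpha_X p; have := alpha_X q.
rewrite pq !(alpha_coords _ (X _, _)) !(alpha_coords _ u) !(alpha_coords _ v).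
rewrite u0 v0 /= !mul0r !addr0 => qX pX.
have D := proportional_of_common_kernel (X_neq0 q.2) pX qX.
apply/eqP; rewrite -subr_eq0.
rewrite [X in X == 0](_ : _ = (u.1 0 0 * v.1 1 0 - u.1 1 0 * v.1 0 0) *
  (alpha p (e 0) * alpha q (e 1) - alpha p (e 1) * alpha q (e 0))); last by ring.
by rewrite D subrr mulr0.
Qed.

Lemma is_derive_alpha p v :
  is_derive p.2 (1 : R) (fun t => alpha (p.1, t) v) ('D_ez (fun q => alpha q v) p).
Proof. exact/derivable_along_fiber/derivable_alpha. Qed.

(* Differentiating the proportionality alpha_p(Y) alpha_q(W) = alpha_p(W) alpha_q(Y)
   in phi_3, where alpha_p(Y) = alpha_q(Y) = 0 and both derivatives of alpha(Y)
   have absolute value 1; no regularity of X is needed.                       *)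
Lemma norm_alpha_JX p q : p.2 = q.2 -> `|alpha p (JX p.2)| = `|alpha q (JX p.2)|.
Proof.
move=> pq; set Y : V := (X p.2, 0); set W := JX p.2.
have dpY := is_derive_alpha p Y; have dpW := is_derive_alpha p W.
have dqY := is_derive_alpha q Y; have dqW := is_derive_alpha q W.
rewrite -pq in dqY dqW.
have d1 := is_deriveM dpY dqW; have d2 := is_deriveM dpW dqY.
have E : (fun t => alpha (p.1, t) Y) * (fun t => alpha (q.1, t) W) =
    (fun t => alpha (p.1, t) W) * (fun t => alpha (q.1, t) Y).
  by apply/funext => t; exact: alpha_proportional.
move: (@derive_val _ _ _ _ _ _ _ d2); rewrite -E (@derive_val _ _ _ _ _ _ _ d1) /=.
have pE : (p.1, p.2) = p by case: (p).
have qE : (q.1, p.2) = q by rewrite pq; case: (q).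
have qY : alpha q Y = 0 by rewrite /Y pq alpha_X.
rewrite pE qE alpha_X qY !scale0r add0r addr0 => /(congr1 Num.norm).
rewrite !normrM derive_alpha_X [in X in _ = _ * X -> _]/Y pq derive_alpha_X !mulr1.
by move=> <-.
Qed.

(** Along the segment from the origin of the fibre the value is continuous, never zero and of
    constant absolute value, so its sign cannot change. *)
Lemma alpha_JX_fiber p : alpha p (JX p.2) = alpha (0, p.2) (JX p.2).
Proof.
case: p => c z /=; set W := JX z.
pose g s := alpha (s *: c, z) W.
have gN s : `|g s| = `|g 0| by apply: (@norm_alpha_JX (s *: c, z) (0 *: c, z)).
have gc : continuous g.
  move=> s; apply: (@continuous_comp R V R (fun t : R => (t *: c, z) : V) (fun q => alpha q W)).
    apply: (@cvg_pair _ _ _ _ (nbhs (s *: c)) (nbhs z)); last exact: cvg_cst.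
    exact: scalel_continuous.
  exact/differentiable_continuous/differentiable_alpha.
have g0 s : g s != 0 by exact: (alpha_JX_neq0 (s *: c, z)).
suff : g 1 = g 0 by rewrite /g scale1r scale0r.
have /eqP := gN 1; rewrite eqr_norm2 => /orP[/eqP//|/eqP g1].
have mm : Num.min (g 0) (g 1) <= 0 <= Num.max (g 0) (g 1).
  rewrite g1 ge_min le_max oppr_le0 oppr_ge0.
  by case: (leP 0 (g 0)) => [//|/ltW ->]; rewrite ?orbT.
have [s _ gs] := IVT ler01 (continuous_subspaceT gc) mm.
by have := g0 s; rewrite gs eqxx.
Qed.

Lemma alpha_fiber p v : alpha p v = alpha (0, p.2) v.
Proof.
have := alpha_JX_fiber p; have := alpha_X p; have := alpha_X (0, p.2).
rewrite !(alpha_coords _ (X _, _)) !(alpha_coords _ (JX _)) !(alpha_coords _ v).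
rewrite !alpha_ez /= !mxE /= !mul0r !mulr0 !addr0.
have := X_neq0 p.2; set y0 := X _ _ _; set y1 := X _ _ _.
set a0 := alpha _ _; set a1 := alpha _ _; set b0 := alpha _ _; set b1 := alpha _ _.
move=> y0N0 bX aX abJ.
by have [-> ->] := eq_of_orthogonal_coords y0N0 (etrans aX (esym bX)) abJ.
Qed.

(** By [alpha_fiber], [alpha] is h_0 dphi_1 + h_1 dphi_2 with coefficients in [phi_3] alone; [hd]
    and [hdd] are their first two derivatives. *)
Let h i z := alpha (0, z) (e i).
Let hd i z := 'D_ez (fun q => alpha q (e i)) (0, z).
Let hdd i z := 'D_ez ('D_ez (fun q => alpha q (e i))) (0, z).

Let is_derive_h i z : is_derive z (1 : R) (h i) (hd i z).
Proof. exact: (is_derive_alpha (0, z)). Qed.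

Let is_derive_hd i z : is_derive z (1 : R) (hd i) (hdd i z).
Proof.
apply: (@derivable_along_fiber _ _ _ ('D_ez (fun q => alpha q (e i))) (0, z)).
exact: diff_derivable (formA.2 (e i) [:: ez] (0, z)).
Qed.

Let continuous_hdd i : continuous (hdd i).
Proof.
move=> z; apply: (@continuous_comp R V R (fun t : R => (0, t) : V)
  ('D_ez ('D_ez (fun q => alpha q (e i))))).
  by apply: (@cvg_pair _ _ _ _ (nbhs (0 : 'cV[R]_2)) (nbhs z)); [exact: cvg_cst|exact: cvg_id].
exact: differentiable_continuous (formA.2 (e i) [:: ez; ez] (0, z)).
Qed.

Let continuous_hd i : continuous (hd i).
Proof.
by move=> z; apply/differentiable_continuous/derivable1_diffP; have [] := is_derive_hd i z.
Qed.

Lemma alpha_h p v : alpha p v = v.1 0 0 * h 0 p.2 + v.1 1 0 * h 1 p.2.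
Proof. by rewrite alpha_fiber alpha_coords alpha_ez mulr0 addr0. Qed.

Lemma derive_alpha_hd p v :
  'D_ez (fun q => alpha q v) p = v.1 0 0 * hd 0 p.2 + v.1 1 0 * hd 1 p.2.
Proof.
have d1 := is_derive_alpha p v.
have d2 : is_derive p.2 (1 : R) (fun t => alpha (p.1, t) v)
    (v.1 0 0 * hd 0 p.2 + v.1 1 0 * hd 1 p.2).
  have -> : (fun t => alpha (p.1, t) v) = (v.1 0 0 \*: h 0) + (v.1 1 0 \*: h 1).
    by apply/funext => t; rewrite alpha_h.
  exact: (is_deriveD (is_deriveZ _ (is_derive_h 0 _)) (is_deriveZ _ (is_derive_h 1 _))).
by rewrite -(@derive_val _ _ _ _ _ _ _ d1) (@derive_val _ _ _ _ _ _ _ d2).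
Qed.

(** The Wronskian of the coefficients: up to sign, the density of the volume form given by [alpha]
    wedge its differential. *)
Let Delta z := h 0 z * hd 1 z - h 1 z * hd 0 z.

(** Cramer's solution n of h_0 n_0 + h_1 n_1 = 1 and hd_0 n_0 + hd_1 n_1 = 0. *)
Definition reeb_velocity z : 'cV[R]_2 :=
  \col_i ((if i == 0 then hd 1 z else - hd 0 z) / Delta z).

Variable nu : V -> V.
Hypothesis reebA : forall p, alpha p (nu p) = 1 /\ forall v, dform alpha p (nu p) v = 0.

Lemma reeb_derive_ez p : 'D_ez (fun q => alpha q (nu p)) p = 0.
Proof.
have := (reebA p).2 ez; rewrite /dform derive_alpha_ez sub0r => /eqP.
by rewrite oppr_eq0 => /eqP.
Qed.

Lemma derive_alpha_horizontal p (u : 'cV[R]_2) v : 'D_(u, 0) (fun q => alpha q v) p = 0.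
Proof.
rewrite /derive (_ : (fun k : R => _) = cst 0) ?lim_cst//.
apply/funext => k /=; rewrite !(alpha_h _ v) /= scaler0 add0r subrr.
exact: scaler0.
Qed.

(** Horizontal derivatives of [alpha] vanish, so pairing [nu] with [X] in [dform] leaves the third
    component of [nu] times a factor of absolute value 1. *)
Lemma reeb_horizontal p : (nu p).2 = 0.
Proof.
have := (reebA p).2 (X p.2, 0); rewrite /dform derive_alpha_horizontal subr0 => E0.
have nuE : nu p = ((nu p).1, 0) + (nu p).2 *: ez.
  case: (nu p) => u a; congr pair; rewrite /= ?scaler0 ?addr0// add0r.
  exact/esym/mulr1.
rewrite nuE deriveE in E0; last exact: differentiable_alpha.
rewrite linearD linearZ -!deriveE in E0; [|exact: differentiable_alpha..].
move/eqP: E0; rewrite derive_alpha_horizontal add0r scaler_eq0 => /orP[/eqP //|/eqP E].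
by have := derive_alpha_X p; rewrite E normr0 => /eqP; rewrite eq_sym oner_eq0.
Qed.

Lemma Delta_neq0 z : Delta z != 0.
Proof.
pose p : V := (0, z); set n := (nu p).1.
have E1 := (reebA p).1; have E2 := reeb_derive_ez p; have E3 := alpha_X p.
have E4 : 'D_ez (fun q => alpha q (X p.2, 0)) p != 0.
  by rewrite -normr_eq0 derive_alpha_X oner_eq0.
rewrite !derive_alpha_hd !alpha_h /= in E1 E2 E3 E4.
apply/eqP => D0; move/eqP: E4; apply.
rewrite -[LHS]mul1r -E1.
(* In this identity the first factor on the left is 1 and [alpha] kills [X], so a zero [Delta] would
   make the derivative of [alpha] on [X] vanish. *)
have -> : ((nu p).1 0 0 * h 0 z + (nu p).1 1 0 * h 1 z) *
    (X z 0 0 * hd 0 z + X z 1 0 * hd 1 z) =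
  Delta z * ((nu p).1 0 0 * X z 1 0 - (nu p).1 1 0 * X z 0 0) +
  (X z 0 0 * h 0 z + X z 1 0 * h 1 z) * ((nu p).1 0 0 * hd 0 z + (nu p).1 1 0 * hd 1 z).
  by rewrite /Delta; ring.
by rewrite D0 E3 !mul0r addr0.
Qed.

Lemma reeb_fieldE p : nu p = (reeb_velocity p.2, 0).
Proof.
have E1 := (reebA p).1; have E2 := reeb_derive_ez p; have D0 := Delta_neq0 p.2.
rewrite derive_alpha_hd alpha_h in E1 E2.
have := reeb_horizontal p; case: (nu p) E1 E2 => n a /= E1 E2 ->; congr pair.
apply/colP => i; rewrite mxE; apply: (mulIf D0); rewrite divfK//.
have [->|->] : i = 0 \/ i = 1.
  by case: i => [[|[|//]]] ?; [left|right]; apply: val_inj.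
- have -> : n 0 0 * Delta p.2 =
      hd 1 p.2 * (n 0 0 * h 0 p.2 + n 1 0 * h 1 p.2) -
      h 1 p.2 * (n 0 0 * hd 0 p.2 + n 1 0 * hd 1 p.2) by rewrite /Delta; ring.
  by rewrite E1 E2 mulr1 mulr0 subr0.
- have -> : n 1 0 * Delta p.2 =
      - hd 0 p.2 * (n 0 0 * h 0 p.2 + n 1 0 * h 1 p.2) +
      h 0 p.2 * (n 0 0 * hd 0 p.2 + n 1 0 * hd 1 p.2) by rewrite /Delta; ring.
  by rewrite E1 E2 mulr1 mulr0 addr0.
Qed.

(** Each entry is, up to sign, a quotient of the C^1 functions [hd i] and [Delta]; two derivatives
    of [alpha] enter. *)
Lemma reeb_velocity_lipschitz : exists L, forall (x y : R) i j,
  `[0, 1]%classic x -> `[0, 1]%classic y ->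
  `|reeb_velocity x i j - reeb_velocity y i j| <= L * `|x - y|.
Proof.
pose dDelta z := (h 0 z *: hdd 1 z + hd 1 z *: hd 0 z) -
  (h 1 z *: hdd 0 z + hd 0 z *: hd 1 z).
have dD z : is_derive z (1 : R) Delta (dDelta z).
  apply: (@is_deriveB _ _ _ (h 0 * hd 1) (h 1 * hd 0)); exact: is_deriveM.
have ch i : continuous (h i).
  by move=> z; apply/differentiable_continuous/derivable1_diffP; have [] := is_derive_h i z.
have cD : continuous dDelta.
  move=> z; apply: cvgB; apply: cvgD; apply: cvgM.
  - exact: (ch 0). - exact: (@continuous_hdd 1).
  - exact: (@continuous_hd 1). - exact: (@continuous_hd 0).
  - exact: (ch 1). - exact: (@continuous_hdd 0).
  - exact: (@continuous_hd 0). - exact: (@continuous_hd 1).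
have [L0 L0P] := C1_div_lipschitz (is_derive_hd 1) (@continuous_hdd 1) dD cD Delta_neq0.
have [L1 L1P] := C1_div_lipschitz (is_derive_hd 0) (@continuous_hdd 0) dD cD Delta_neq0.
exists (Num.max L0 L1) => x y i j x01 y01; rewrite !mxE; case: ifP => _.
  by apply: le_trans (L0P _ _ x01 y01) _; rewrite ler_wpM2r// le_max lexx.
rewrite !mulNr -opprD normrN.
by apply: le_trans (L1P _ _ x01 y01) _; rewrite ler_wpM2r// le_max lexx orbT.
Qed.

(** The height is constant along the curve, hence so is the velocity, and subtracting the uniform
    motion leaves a curve with zero derivative. *)
Lemma reeb_flow gamma : (forall t : R, is_derive t (1 : R) gamma (nu (gamma t))) ->
  gamma 1 = ((gamma 0).1 + reeb_velocity (gamma 0).2, (gamma 0).2).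
Proof.
move=> dgamma.
have z_cst t : (gamma t).2 = (gamma 0).2.
  apply: (@is_derive_0_is_cst _ (snd \o gamma)) => s.
  have sc : scalar (@snd 'cV[R]_2 R) by [].
  have csnd : continuous (@snd 'cV[R]_2 R) by move=> p; exact: cvg_snd.
  have d1 := is_derive_comp_scalar sc csnd (dgamma s).
  by apply: (is_derive_eq d1); rewrite reeb_fieldE.
have phi i j : (gamma 1).1 i j = (gamma 0).1 i j + reeb_velocity (gamma 0).2 i j.
  pose l (v : V) := v.1 i j.
  have sc : scalar l by move=> a u v; rewrite /l /= !mxE.
  pose k := reeb_velocity (gamma 0).2 i j.
  have d0 s : is_derive s (1 : R) ((l \o gamma) - (k \*: id)) 0.
    have d1 := is_derive_comp_scalar sc (@continuous_coord_fst _ _ _ i j) (dgamma s).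
    have d2 := is_deriveZ k (is_derive_id s (1 : R)).
    apply: (is_derive_eq (is_deriveB d1 d2)); rewrite reeb_fieldE z_cst /l /= -/k.
    by rewrite [k *: _]mulr1 subrr.
  have := is_derive_0_is_cst 1 0 d0.
  rewrite !fctE /l /= [k *: 1]mulr1 [k *: 0]mulr0 subr0 => <-; exact/esym/subrK.
have -> : gamma 1 = ((gamma 1).1, (gamma 1).2) by case: (gamma 1).
by rewrite z_cst; congr pair; apply/matrixP => i j; rewrite mxE phi.
Qed.

End ReebField.

Theorem theorem2 (R : realType) (A : SL2Z) (S : subriemannian R)
    (constructedS : constructed_structure A S)
    (coorientedS : cooriented A S)
    (alpha : univ_cover R -> univ_cover R -> R)
    (alphaP : normalized_contact_form A S alpha)
    (nu : univ_cover R -> univ_cover R) (nuP : reeb_field A alpha nu)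
    (Phi : R -> mapping_torus R A -> mapping_torus R A)
    (PhiP : flow_of nu Phi) :
  topological_entropy R (Phi 1%R) = 0%E.
Proof.
have [X _ frameS] := constructedS; have [[formA _] _ kerA normA] := alphaP.
have [L lipN] := reeb_velocity_lipschitz frameS formA kerA normA nuP.2.
apply: (topological_entropy_shear _ lipN) => p.
(* The lifted integral curve through [p] shows that the time-one map is a fibrewise translation by
   [reeb_velocity]. *)
have [gamma [<- dgamma ->]] := PhiP p.
by rewrite (reeb_flow frameS formA kerA normA nuP.2 dgamma).
Qed.
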